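(* Let there be $m$ indivisible items and $n$ players, let each player $i\in\{1,\dots,n\}$ have an arbitrary real-valued utility function $u_i$ on the subsets of $\{1,\dots,m\}$, and let $\{A^{(1)},\dots,A^{(k)}\}$ ($k\ge 1$) be the set of allowable allocations. If this allocation set is swappable, then there exists a mixed allocation $\mathbf{p}=(p_1,\dots,p_k)$ that is both Pareto Efficient and envy-free.
   Context: An allocation $A=(A_1,\dots,A_n)$ assigns to each player $i$ a bundle $A_i\subseteq\{1,\dots,m\}$ with $A_i\cap A_h=\emptyset$ for all $h\ne i$ (not all items need be allocated). A fixed finite list of allowable allocations $A^{(1)},\dots,A^{(k)}$ is given, and $A^{(j)}_i$ denotes the bundle that $A^{(j)}$ gives to player $i$. The allocation set is swappable if for every allocation $A^{(j)}$ and every pair of players $g,h$ there is an allocation $A^{(l)}$ in the set with $A^{(l)}_i=A^{(j)}_i$ for all $i\notin\{g,h\}$, $A^{(l)}_h=A^{(j)}_g$ and $A^{(l)}_g=A^{(j)}_h$. A mixed allocation is a probability vector $\mathbf{p}=(p_1,\dots,p_k)$, $p_j\ge 0$, $\sum_j p_j=1$. Player $i$'s expected utility under $\mathbf p$ is $\sum_j p_j u_i(A^{(j)}_i)$. A mixed allocation $\mathbf p$ is Pareto Efficient if there is no mixed allocation $\mathbf p'$ with $\sum_j p'_j u_i(A^{(j)}_i)\ge\sum_j p_j u_i(A^{(j)}_i)$ for all $i$ and strict inequality for at least one $i$. A mixed allocation $\mathbf p$ is envy-free if for every pair of players $i,i'$, $\sum_j p_j u_i(A^{(j)}_i)\ge\sum_j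 p_j u_i(A^{(j)}_{i'})$. *)

(* Defs.v *)
From mathcomp Require Import all_boot all_order all_algebra reals.

Set Implicit Arguments.
Unset Strict Implicit.
Unset Printing Implicit Defensive.

Import Order.TTheory GRing.Theory Num.Theory.
Local Open Scope ring_scope.

Definition bundles (n m : nat) : Type := 'I_n -> {set 'I_m}.

(* The bundles need not cover all items. *)
Definition is_allocation (n m : nat) (B : bundles n m) : Prop :=
  forall i h : 'I_n, h != i -> [disjoint B i & B h].

Definition swappable (n m k : nat) (A : 'I_k -> bundles n m) : Prop :=
  forall (j : 'I_k) (g h : 'I_n), exists l : 'I_k,
    [/\ forall i : 'I_n, i != g -> i != h -> A l i = A j i,
        A l h = A j g
      & A l g = A j h].

Definition mixed_allocation (R : realType) (k : nat) (p : 'I_k -> R) : Prop :=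
  (forall j, 0 <= p j) /\ \sum_(j < k) p j = 1.

(* Expected value, in player i's eyes, of the random bundle that p assigns to
   player h; for h = i this is player i's expected utility. *)
Definition expected_value (R : realType) (n m k : nat)
    (u : 'I_n -> {set 'I_m} -> R) (A : 'I_k -> bundles n m)
    (p : 'I_k -> R) (i h : 'I_n) : R :=
  \sum_(j < k) p j * u i (A j h).

Definition expected_utility (R : realType) (n m k : nat)
    (u : 'I_n -> {set 'I_m} -> R) (A : 'I_k -> bundles n m)
    (p : 'I_k -> R) (i : 'I_n) : R :=
  expected_value u A p i i.

Definition pareto_efficient (R : realType) (n m k : nat)
    (u : 'I_n -> {set 'I_m} -> R) (A : 'I_k -> bundles n m)
    (p : 'I_k -> R) : Prop :=
  ~ exists p' : 'I_k -> R,
      [/\ mixed_allocation p',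
          forall i, expected_utility u A p' i >= expected_utility u A p i
        & exists i, expected_utility u A p' i > expected_utility u A p i].

Definition envy_free (R : realType) (n m k : nat)
    (u : 'I_n -> {set 'I_m} -> R) (A : 'I_k -> bundles n m)
    (p : 'I_k -> R) : Prop :=
  forall i i' : 'I_n, expected_utility u A p i >= expected_value u A p i i'.

(* Main.v *)
(* Fix weights [w i > 0]. If a lottery [p] only uses allocations of maximal
   weighted welfare it is Pareto efficient, and since the allocations are closed
   under permuting players, no cycle of players each envying the next one can
   exist. So it remains to choose the weights in such a way that no player is
   envious. Take [w i = max e (q i)] with [q] in the standard simplex. A
   complementarity argument yields [q] and an optimal [p] such that the total
   envy of each player [i] is [q i] times the sum [S] of the total envies. If
   [S > 0], then every player with [q i > 0] envies someone; an envied player has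
   at least a fixed fraction [1/K] of the envier's weight, so for small [e]
   following envies from the player with the largest [q i] never leaves the set
   [q > 0] and closes up into a forbidden cycle. Hence [S = 0].

   The complementary [q] comes from a Sperner-type statement about points of a
   fine grid in the simplex, ordered by each of their coordinates (Scarf's
   primitive sets, which replace triangulations); optimality of [p] is first
   relaxed to a softmax, and a compactness argument removes the relaxation. *)
Require Import Defs.
From mathcomp Require Import all_boot all_order all_algebra reals.
From mathcomp Require Import fingroup perm zify lra ring boolp.

Set Implicit Arguments.
Unset Strict Implicit.
Unset Printing Implicit Defensive.

(** * Scarf's primitive sets *)

Section Scarf.
Variables (I X : finType) (r : I -> X -> nat).
Hypothesis r_inj : forall i, injective (r i).

(** Faces of Scarf's complex: no point exceeds, in every order at once, the least element of [S].
    Primitive sets are those of size [#|I|]. *)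
Definition undominated (S : {set X}) : bool :=
  [forall y, exists i, forall s in S, (r i y <= r i s)%N].

Lemma undominatedP (S : {set X}) :
  reflect (forall y, exists i, forall s, s \in S -> (r i y <= r i s)%N)
          (undominated S).
Proof.
apply: (iffP forallP) => H y.
  by have /existsP[i /forall_inP Hi] := H y; exists i.
by have [i Hi] := H y; apply/existsP; exists i; apply/forall_inP.
Qed.

Lemma undominatedS (S S' : {set X}) :
  S \subset S' -> undominated S' -> undominated S.
Proof.
move=> /subsetP sSS' /undominatedP dS'; apply/undominatedP => y.
by have [i Hi] := dS' y; exists i => s /sSS'; apply: Hi.
Qed.

Definition extensions (S : {set X}) : {set X} :=
  [set x | (x \notin S) && undominated (x |: S)].

(* The points that can replace [f i] as the [r i]-least point of [S], when each
   [f k] is the [r k]-least point of [S]. *)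
Definition above (f : I -> X) (i : I) : {set X} :=
  [set y | [forall k, (k != i) ==> (r k (f k) < r k y)%N]].

Lemma aboveP (f : I -> X) (i : I) (y : X) :
  reflect (forall k, k != i -> (r k (f k) < r k y)%N) (y \in above f i).
Proof. by rewrite inE; apply: (iffP forall_inP). Qed.

(** A point of [above f i] extends [S] exactly when it is the [r i]-greatest of these, since a
    higher one would exceed the extended set in every order. *)
Lemma card_extensions_above (S : {set X}) (f : I -> X) (i : I) :
  undominated S ->
  (forall k, f k \in S) -> (forall k s, s \in S -> (r k (f k) <= r k s)%N) ->
  S \subset f @: [set~ i] ->
  #|extensions S :&: above f i| = (above f i != set0).
Proof.
move=> /undominatedP dS fS fmin /subsetP Sf.
have notS x : x \in above f i -> x \notin S.
  move=> /aboveP Mx; apply/negP => /Sf /imsetP[k]; rewrite !inE => ki xE.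
  by have := Mx _ ki; rewrite xE ltnn.
have extE x : x \in above f i ->
    (x \in extensions S) = [forall y in above f i, (r i y <= r i x)%N].
  move=> Mx; rewrite inE notS //=.
  apply/undominatedP/forall_inP => [dx y /aboveP My|mx y].
    have [k Hk] := dx y; have [<-|ki] := eqVneq k i.
      by apply: Hk; rewrite setU11.
    have := My _ ki; rewrite ltnNge Hk // inE fS orbT //.
  have [My|] := boolP (y \in above f i).
    exists i => s; rewrite !inE => /orP[/eqP ->|sS]; first exact: mx.
    have [k Hk] := dS y; have [<-|ki] := eqVneq k i; first exact: Hk.
    by move/aboveP: My => /(_ _ ki); rewrite ltnNge Hk.
  rewrite inE negb_forall_in => /exists_inP[k ki]; rewrite -leqNgt => yk.
  exists k => s; rewrite !inE => /orP[/eqP ->|sS].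
    by apply: leq_trans yk (ltnW _); move/aboveP: Mx; apply.
  exact: leq_trans yk (fmin _ _ sS).
have [->|/set0Pn[x0 Mx0]] := eqVneq (above f i) set0.
  by rewrite setI0 cards0.
case: (@arg_maxnP _ x0 (mem (above f i)) (r i) Mx0) => x Mx maxx /=.
apply/eqP/cards1P; exists x; apply/setP => y; rewrite in_setI in_set1.
apply/andP/eqP => [[ye My]|->].
  move: ye; rewrite extE // => /forall_inP/(_ _ Mx) xy.
  by apply: (r_inj (i := i)); apply/eqP; rewrite eqn_leq xy andbT; exact: maxx.
by split=> //; rewrite extE //; apply/forall_inP => z /maxx.
Qed.

(** Each point of [S] is least in some order, so [f] maps onto [S], and counting leaves a single
    coincidence [f i = f j]. A new point must take over one of these two orders; thus [S], like a
    facet in a triangulation, lies in at most two primitive sets. *)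
Lemma card_extensions (S : {set X}) :
  undominated S -> S != set0 -> #|S|.+1 = #|I| ->
  exists f i j,
    [/\ i != j, forall k, f k \in S,
        forall k s, s \in S -> (r k (f k) <= r k s)%N
      & #|extensions S| = (above f i != set0) + (above f j != set0)].
Proof.
move=> dS0 /set0Pn[s0 s0S] cS.
have /undominatedP dS := dS0.
pose f k := [arg min_(s < s0 | s \in S) r k s]%N.
have fS k : f k \in S by rewrite /f; case: arg_minnP.
have fmin k s : s \in S -> (r k (f k) <= r k s)%N.
  by rewrite /f; case: arg_minnP => // x _; apply.
have fP k s : s \in S -> (forall t, t \in S -> (r k s <= r k t)%N) -> f k = s.
  by move=> sS smin; apply: (r_inj (i := k)); apply/eqP; rewrite eqn_leq fmin ?smin.
have imf : f @: setT = S.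
  apply/setP => s; apply/imsetP/idP => [[k _ ->]|sS]; first exact: fS.
  by have [k Hk] := dS s; exists k => //; rewrite (fP k s).
have cC (i : I) : #|[set~ i]| = #|S|.
  by rewrite cardsC1 -cS.
have /dinjectivePn[i _ [j ij fij]] : ~~ dinjectiveb f [set: I].
  apply/negP => /dinjectiveP /card_in_imset; rewrite imf cardsT -cS.
  by move/eqP; rewrite eqn_leq ltnn andbF.
have {ij} ji : j != i by move: ij; rewrite !inE andbT.
have Simf l l' : l != l' -> f l = f l' -> S \subset f @: [set~ l].
  move=> ll' fll'; apply/subsetP => s; rewrite -{1}imf => /imsetP[k _ ->].
  have [->|kl] := eqVneq k l; last by apply: imset_f; rewrite !inE.
  by rewrite fll'; apply: imset_f; rewrite !inE eq_sym.
exists f, i, j; split=> //; first by rewrite eq_sym.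
rewrite -(card_extensions_above (i := i) dS0) //; last first.
  by apply: (Simf _ j); rewrite // eq_sym.
rewrite -(card_extensions_above (i := j) dS0) //; last exact: (Simf _ i).
rewrite -cardsUI.
(* A point in both sets would exceed [S] in every order. *)
have -> : extensions S :&: above f i :&: (extensions S :&: above f j) = set0.
  apply/setP => x; rewrite in_set0; apply/negP => /setIP[/setIP[_ /aboveP Mi]].
  move=> /setIP[_ /aboveP Mj]; have [k Hk] := dS x.
  have := Hk _ (fS k); apply/negP; rewrite -ltnNge.
  by have [->|ki] := eqVneq k i; [apply: Mj; rewrite eq_sym|apply: Mi].
rewrite cards0 addn0 -setIUr; congr #|pred_of_set _|.
apply/esym/setIidPl/subsetP => x; rewrite inE => /andP[xS /undominatedP dx].
(* Since [x] is least in the order [l], each point of [S] has to be least in some other order; so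
   [f] is injective off [l], and [l] is [i] or [j]. *)
have [l Hl] := dx x.
have cov s : s \in S -> exists2 k, k != l & (f k = s) /\ (r k s < r k x)%N.
  move=> sS; have [k Hk] := dx s.
  have rsx : (r k s <= r k x)%N by apply: Hk; rewrite setU11.
  have sx : s != x by apply: contraNneq xS => <-.
  exists k.
    apply: contra_neq sx => kl; apply: (r_inj (i := k)); apply/eqP.
    by rewrite eqn_leq rsx kl Hl // inE sS orbT.
  split; first by apply: fP => // t tS; apply: Hk; rewrite inE tS orbT.
  by rewrite ltn_neqAle rsx andbT; apply: contra_neq sx; apply: r_inj.
have fl : {in [set~ l] &, injective f}.
  apply/imset_injP; rewrite cC -(_ : f @: [set~ l] = S) //.
  apply/setP => s; apply/imsetP/idP => [[k _ ->]//|/cov[k kl [<- _]]].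
  by exists k => //; rewrite !inE.
have Ml : x \in above f l.
  apply/aboveP => k kl; have [k' k'l [fk' rk']] := cov _ (fS k).
  by rewrite -(fl _ _ _ _ fk') ?inE // fk'.
rewrite inE; have [li|li] := eqVneq l i; first by rewrite -li Ml.
have [lj|lj] := eqVneq l j; first by rewrite -lj Ml orbT.
have := fl i j; rewrite !inE ![_ == l]eq_sym li lj => /(_ isT isT fij) ij.
by move: ji; rewrite ij eqxx.
Qed.


(* The slack points [w i] make all sets of interest have exactly [#|I|]
   elements, so that there is a single kind of facet to count. *)
Section Parity.
Variables (w : I -> X) (c : X -> I) (t0 : X) (i0 : I).
Hypothesis w_low : forall i y, (r i (w i) <= r i y)%N.
Hypothesis w_high :
  forall i k y, k != i -> y \notin codom w -> (r k y < r k (w i))%N.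
Hypothesis c_w : forall i, c (w i) = i.
Hypothesis t0w : t0 \notin codom w.

(** The doors of Sperner's parity argument; the cardinality forces the labels to be distinct. *)
Let facet (S : {set X}) := (#|S|.+1 == #|I|) && (c @: S == [set~ i0]).
Let S0 := w @: [set~ i0].

(** Double counting of the incidences between doors and primitive sets. *)
Lemma sum_card_extensions_facet :
  \sum_(S : {set X} | facet S) #|extensions S| =
  \sum_(S : {set X} | (#|S| == #|I|) && undominated S)
     #|[set x in S | facet (S :\ x)]|.
Proof.
under eq_bigr do rewrite -sum1_card.
under [RHS]eq_bigr do rewrite -sum1_card.
rewrite (exchange_big_dep xpredT) //= [RHS](exchange_big_dep xpredT) //=.
apply: eq_bigr => x _.
rewrite (reindex_onto (fun S : {set X} => S :\ x) (fun S => x |: S)); last first.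
  by move=> S /andP[_]; rewrite inE => /andP[xS _]; rewrite setU1K.
apply: eq_bigl => S; rewrite !inE eqxx /=.
have [xS|xS] := boolP (x \in S); last first.
  rewrite andbF; apply/negP => /andP[_ /eqP H].
  by move: xS; rewrite -H setU11.
rewrite setD1K // eqxx andbT /= andbC /facet.
by rewrite [in RHS](cardsD1 x S) xS add1n; case: eqP => //=; rewrite ?andbF.
Qed.

(** In each order but [i0] the least point is a slack in [S0], and in the order [i0] these slacks
    are above all other points. So only the [r i0]-greatest non-slack point can be added; [w i0]
    cannot, as [t0] would exceed all slacks. *)
Lemma card_extensions_slacks : #|extensions S0| = 1%N.
Proof.
have wS0 i : i != i0 -> w i \in S0.
  by move=> ii0; apply: imset_f; rewrite !inE.
have tS0 t : t \notin codom w -> t \notin S0.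
  by apply: contraNN => /imsetP[i _ ->]; apply: codom_f.
have noslack t i : t \notin codom w -> (r i t <= r i (w i))%N = false.
  move=> tw; apply/negbTE; rewrite -ltnNge ltn_neqAle w_low andbT.
  by apply: contraNneq tw => /r_inj <-; apply: codom_f.
have extE t : t \notin codom w -> (t \in extensions S0) =
    [forall y in [predC codom w], (r i0 y <= r i0 t)%N].
  move=> tw; rewrite inE tS0 //=; apply/undominatedP/forall_inP => [dt y yw|mt y].
    have [i Hi] := dt y; have [<-|ii0] := eqVneq i i0; first by rewrite Hi ?setU11.
    by have := Hi (w i); rewrite inE wS0 // orbT noslack // => /(_ isT).
  have [/codomP[i ->]|yw] := boolP (y \in codom w).
    by exists i.
  exists i0 => s; rewrite !inE => /orP[/eqP ->|/imsetP[k]]; first exact: mt.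
  by rewrite !inE eq_sym => ki0 ->; apply/ltnW/w_high.
case: (@arg_maxnP _ t0 (mem [predC codom w]) (r i0) t0w) => t tw maxt.
apply/eqP/cards1P; exists t; apply/setP => y; rewrite in_set1.
apply/idP/eqP => [ye|->]; last first.
  by rewrite extE //; apply/forall_inP => z /maxt.
have yw : y \notin codom w.
  apply/negP => /codomP[i yE]; subst y; move: ye; rewrite inE => /andP[wi].
  have ii0 : i = i0 by apply/eqP; apply: contraNT wi; apply: wS0.
  move=> /undominatedP/(_ t0)[k Hk].
  have wk : w k \in w i |: S0.
    rewrite inE; have [->|ki] := eqVneq k i; first by rewrite inE eqxx.
    by rewrite wS0 ?orbT // -ii0.
  by have := Hk _ wk; rewrite noslack.
move: ye; rewrite extE // => /forall_inP/(_ _ tw) ty.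
apply: (r_inj (i := i0)); apply/eqP; rewrite eqn_leq ty andbT; exact: maxt.
Qed.

(** [S0] is the one boundary door: any other has two extensions if undominated and none
    otherwise. *)
Lemma odd_sum_card_extensions :
  odd (\sum_(S : {set X} | facet S) #|extensions S|).
Proof.
have w_inj : injective w by apply: can_inj c_w.
have cS0 : c @: S0 = [set~ i0].
  by rewrite -imset_comp (eq_imset (g := id)) ?imset_id // => i /=; rewrite c_w.
have facet0 : facet S0.
  rewrite /facet cS0 eqxx andbT card_imset // cardsC1 prednK //.
  by apply/card_gt0P; exists i0.
rewrite (bigD1 S0) //= card_extensions_slacks oddD /=.
rewrite (big_morph odd oddD (erefl _)) big1 // => S /andP[/andP[/eqP cS /eqP fS] SS0].
have [dS|ndS] := boolP (undominated S); last first.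
  rewrite [extensions S](_ : _ = set0) ?cards0 //; apply/setP => x.
  rewrite !inE; apply/negP => /andP[_ dx]; apply/negP: ndS.
  by rewrite negbK; apply: undominatedS dx; apply: subsetUr.
have [S_eq0|S_neq0] := eqVneq S set0.
  case/eqP: SS0; rewrite S_eq0; apply/esym/eqP; rewrite -cards_eq0.
  by rewrite card_imset // cardsC1 -cS S_eq0 cards0.
have [f [i [j [ij fS' fmin ->]]]] := card_extensions dS S_neq0 cS.
(* The slack [w l] itself lies in [above f l]. Otherwise, in some order [k != l], all of [S] is at
   least as high as [w l]; then [S] consists of slacks and its labels force [S = S0]. *)
have above0 l : above f l != set0.
  apply/negP => /eqP Ml; have : w l \notin above f l by rewrite Ml inE.
  rewrite inE negb_forall_in => /exists_inP[k kl]; rewrite -leqNgt => wlk.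
  have Sw s : s \in S -> s \in codom w.
    move=> sS; apply: contraT => sw.
    have := leq_ltn_trans (leq_trans wlk (fmin k s sS)) (w_high kl sw).
    by rewrite ltnn.
  case/eqP: SS0; apply/eqP; rewrite eqEcard; apply/andP; split.
    apply/subsetP => s sS; have /codomP[m sE] := Sw _ sS.
    rewrite sE imset_f // -fS; apply/imsetP; exists s => //.
    by rewrite sE c_w.
  by rewrite card_imset // cardsC1 -cS.
by rewrite !above0.
Qed.

(** If removing [x0] leaves a door, the label of [x0] recurs at exactly one other point [x1], and
    the doors arise by removing [x0] or [x1]. *)
Lemma even_card_facets (S : {set X}) :
  #|S| = #|I| -> c @: S != setT -> ~~ odd #|[set x in S | facet (S :\ x)]|.
Proof.
move=> cS notT.
have [->|/set0Pn[x0]] := eqVneq [set x in S | facet (S :\ x)] set0.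
  by rewrite cards0.
rewrite inE => /andP[x0S /andP[/eqP cx0 /eqP fx0]].
have inj0 : {in S :\ x0 &, injective c}.
  by apply/imset_injP; rewrite fx0 cardsC1 -cx0.
have cx0i0 : c x0 \in [set~ i0].
  rewrite !inE; apply: contraNneq notT => cx; apply/eqP/setP => i; rewrite in_setT.
  have [->|ii0] := eqVneq i i0; first by rewrite -cx imset_f.
  have : i \in [set~ i0] by rewrite !inE.
  rewrite -fx0 => /imsetP[y]; rewrite inE => /andP[_ yS] ->.
  exact: imset_f.
move: (cx0i0); rewrite -fx0 => /imsetP[x1 x1S cx01].
have /andP[x10 x1S'] : (x1 != x0) && (x1 \in S) by rewrite !inE in x1S.
rewrite (_ : [set x in S | _] = [set x0; x1]) ?cards2 1?eq_sym ?x10 //.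
apply/setP => x; rewrite !inE; apply/idP/orP => [/andP[xS /andP[_ /eqP fx]]|].
  have [|xx0] := eqVneq x x0; [by left|right].
  have xS0 : x \in S :\ x0 by rewrite !inE xx0.
  have : c x \in c @: (S :\ x) by rewrite fx -fx0 imset_f.
  case/imsetP => y; rewrite !inE => /andP[yx yS] cxy.
  have [yx0|yx0] := eqVneq y x0.
    by apply/eqP/inj0 => //; rewrite cxy yx0.
  by case/eqP: yx; apply: inj0 => //; rewrite !inE yx0.
case=> /eqP ->; first by rewrite x0S /facet cx0 fx0 !eqxx.
rewrite x1S' /facet -cx0; have := cardsD1 x0 S; rewrite x0S (cardsD1 x1 S) x1S'.
move=> /eqP; rewrite !add1n !eqSS => -> /=; rewrite -fx0; apply/eqP/setP => i.
apply/imsetP/imsetP => -[y]; rewrite !inE => /andP[yx yS] ->.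
  have [->|yx0] := eqVneq y x0; first by exists x1.
  by exists y; rewrite // !inE yx0.
have [->|yx1] := eqVneq y x1; first by exists x0; rewrite // !inE eq_sym x10.
by exists y; rewrite // !inE yx1.
Qed.

Theorem exists_undominated_surjective :
  exists2 S, undominated S & c @: S = setT.
Proof.
have [/existsP[S /andP[dS /eqP fS]]|no] :=
  boolP [exists S, undominated S && (c @: S == setT)]; first by exists S.
have := odd_sum_card_extensions; rewrite sum_card_extensions_facet.
rewrite (big_morph odd oddD (erefl _)) big1 // => S /andP[/eqP cS dS].
apply/negbTE/even_card_facets => //; apply: contraNneq no => fS.
by apply/existsP; exists S; rewrite dS fS eqxx.
Qed.

End Parity.
End Scarf.

(** * Close labelled points on a grid of the simplex *)

Section Grid.
Variables (n N : nat) (i0 : 'I_n).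

Let grid : finType := {y : {ffun 'I_n -> 'I_N.+1} | \sum_i y i == N}.
Let coord (y : grid) (i : 'I_n) : nat := val y i.

Lemma grid_of_sum (f : 'I_n -> nat) :
  (\sum_i f i = N)%N -> exists y : grid, coord y =1 f.
Proof.
move=> sumf; pose y := [ffun i => inord (f i) : 'I_N.+1].
have yE i : y i = f i :> nat.
  by rewrite ffunE inordK // ltnS -sumf (bigD1 i) //= leq_addr.
have sumy : \sum_i y i == N by under eq_bigr do rewrite yE; apply/eqP.
by exists (exist _ y sumy) => i; apply: yE.
Qed.

(* The order of the [i]-th coordinate, ties broken by [enum_rank]; [inl k] is
   a slack point below everything in the order [k] and above the grid in all
   the others. *)
Let grid_rank (i : 'I_n) (x : 'I_n + grid) : nat :=
  match x with
  | inl k => if k == i then 0 else (N.+1 * #|grid| + k).+1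
  | inr y => (coord y i * #|grid| + enum_rank y).+1
  end.

Lemma grid_rank_inj i : injective (grid_rank i).
Proof.
have lt_slack y k :
    (coord y i * #|grid| + enum_rank y < N.+1 * #|grid| + k)%N.
  rewrite (@leq_trans ((coord y i).+1 * #|grid|)) //.
    by rewrite mulSn addnC ltn_add2r.
  by rewrite (leq_trans _ (leq_addr _ _)) // leq_mul2r ltn_ord orbT.
case=> [k|y] [k'|y'] /=.
- case: eqVneq => [->|_]; first by case: eqVneq => [->|].
  by case: eqVneq => // _ [] /addnI /val_inj ->.
- by case: eqVneq => // _ [] E; have := lt_slack y' k; rewrite -E ltnn.
- by case: eqVneq => // _ [] E; have := lt_slack y k'; rewrite -E ltnn.
- case=> E; congr inr; apply/enum_rank_inj/val_inj => /=.
  by have := congr1 (modn^~ #|grid|) E; rewrite /= !modnMDl !modn_small.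
Qed.

Lemma grid_rank_inr_le i (y s : grid) :
  (grid_rank i (inr y) <= grid_rank i (inr s))%N -> (coord y i <= coord s i)%N.
Proof.
rewrite /= ltnS => le_ys; rewrite -ltnS.
rewrite -(@ltn_pmul2r #|grid|) ?(leq_trans _ (ltn_ord (enum_rank y))) //.
apply: leq_ltn_trans (leq_trans (leq_addr _ _) le_ys) _.
by rewrite mulSn addnC ltn_add2r.
Qed.

(** Take a fully labelled undominated set [S]. No grid point exceeds it in all orders, so the least
    coordinates of its grid points nearly sum to [N], which confines these points to a small
    simplex. If the label [g] comes from the slack point [inl g], then the grid points of [S] are
    near the face where coordinate [g] vanishes, and any of them serves. *)
Lemma exists_close_labelled_points (c : ('I_n -> nat) -> 'I_n) :
  exists s : 'I_n -> 'I_n -> nat,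
    [/\ forall g, (\sum_i s g i = N)%N,
        forall g h i, (s g i < s h i + n)%N
      & forall g, c (s g) = g \/ (s g g < n)%N].
Proof.
have [t0 _] : exists y : grid, coord y =1 (fun i => if i == i0 then N else 0).
  by apply: grid_of_sum; rewrite -big_mkcond big_pred1_eq.
pose w : 'I_n -> 'I_n + grid := inl.
pose lab (x : 'I_n + grid) := match x with inl k => k | inr y => c (coord y) end.
have notw y : inr y \notin codom w by apply/negP => /codomP[].
have [||//||S /undominatedP dS labS] :=
  @exists_undominated_surjective _ _ grid_rank grid_rank_inj w lab (inr t0) i0.
- by move=> i y /=; rewrite eqxx.
- move=> i k [l|y] ki; first by rewrite codom_f.
  move=> _ /=; rewrite eq_sym (negbTE ki) ltnS.
  rewrite (@leq_trans ((coord y k).+1 * #|grid|)) //.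
    by rewrite mulSn addnC ltn_add2r.
  by rewrite (leq_trans _ (leq_addr _ _)) // leq_mul2r ltn_ord orbT.
- exact: notw.
have slackS y i : (forall s, s \in S -> (grid_rank i (inr y) <= grid_rank i s)%N) ->
    inl i \notin S.
  by move=> H; apply/negP => /H /=; rewrite eqxx.
have [y0 y0S] : exists y, inr y \in S.
  have [i Hi] := dS (inr t0).
  have : i \in lab @: S by rewrite labS.
  case/imsetP => -[k|y] yS; last by exists y.
  by move=> /= iE; move: (slackS _ _ Hi); rewrite iE yS.
pose m i := coord [arg min_(y < y0 | inr y \in S) coord y i]%N i.
(* A grid point whose coordinate [i] is at least [b i] lies above the least element of [S] in the
   order [i]: everything is above the slack point, and the successor rules out ties. *)
pose b (i : 'I_n) := if inl i \in S then 0 else (m i).+1.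
have mP i y : inr y \in S -> (m i <= coord y i)%N.
  by rewrite /m; case: arg_minnP => // x _; apply.
have b_le y i : inr y \in S -> (b i <= (coord y i).+1)%N.
  by move=> yS; rewrite /b; case: ifP => // _; apply: mP.
have sumb : (N < \sum_i b i)%N.
  rewrite ltnNge; apply/negP => leb.
  (* Topping up [b] at [i0] would give a grid point that exceeds [S] in every order. *)
  have [|y yE] := @grid_of_sum (fun i => b i + if i == i0 then N - \sum_i b i else 0).
    by rewrite big_split /= -big_mkcond big_pred1_eq subnKC.
  have [i Hi] := dS (inr y); have iS := slackS _ _ Hi.
  have [z zS mE] : exists2 z, inr z \in S & m i = coord z i.
    by rewrite /m; case: arg_minnP => // z zS _; exists z.
  have := grid_rank_inr_le (Hi _ zS).
  by rewrite yE /b (negbTE iS) -mE addSn ltnNge leq_addr.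
have sumc y : (\sum_i coord y i = N)%N by apply/eqP; apply: (valP y).
have upper y i : inr y \in S -> (coord y i + 1 < b i + n)%N.
  move=> yS; have le_rest : (\sum_(j | j != i) b j <= \sum_(j | j != i) (coord y j).+1)%N.
    by apply: leq_sum => j _; apply: b_le.
  have restE : (\sum_(j | j != i) (coord y j).+1 = \sum_(j | j != i) coord y j + n.-1)%N.
    under eq_bigr do rewrite -addn1.
    by rewrite big_split /= sum1_card cardC1 card_ord.
  have sumbE : (\sum_j b j = b i + \sum_(j | j != i) b j)%N by rewrite (bigD1 i).
  have sumyE : (\sum_j coord y j = coord y i + \sum_(j | j != i) coord y j)%N.
    by rewrite (bigD1 i).
  move: sumb (sumc y) le_rest; rewrite sumbE sumyE restE /=.
  by have := ltn_ord i; lia.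
have rep g : exists y, inr y \in S /\ (c (coord y) = g \/ inl g \in S).
  have : g \in lab @: S by rewrite labS.
  case/imsetP => -[k|y] yS /= ->; last by exists y; split; [|left].
  by exists y0; split; [|right].
have [y yP] := choice rep.
exists (fun g => coord (y g)); split=> [g|g h i|g]; first exact: sumc.
  have [yg _] := yP g; have [yh _] := yP h.
  by have := upper _ i yg; have := b_le _ i yh; lia.
have [yg [cg|gS]] := yP g; [by left|right].
by have := upper _ g yg; rewrite /b gS; lia.
Qed.

End Grid.

Import Order.TTheory GRing.Theory Num.Theory.

(** * Envy and weighted welfare *)

Section Envy.
Local Open Scope ring_scope.
Variables (R : realType) (n m k : nat).
Variables (u : 'I_n -> {set 'I_m} -> R) (A : 'I_k -> bundles n m).
Hypothesis hswap : swappable A.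

Implicit Types (w : 'I_n -> R) (p : 'I_k -> R).

Definition welfare w (j : 'I_k) : R := \sum_i w i * u i (A j i).

(** For [p j >= 0] this means that [p j > 0] only at maximal welfare. As a weak inequality it is a
    closed condition on [w] and [p], and so survives limits. *)
Definition supported_on_optima w p : Prop :=
  forall j l, p j * (welfare w l - welfare w j) <= 0.

Definition envy p (g h : 'I_n) : R :=
  expected_value u A p g h - expected_utility u A p g.

Definition total_envy p (g : 'I_n) : R := \sum_h Num.max 0 (envy p g h).

Lemma swappable_perm (s : {perm 'I_n}) (j : 'I_k) :
  exists l, forall i, A l i = A j (s i).
Proof.
have [ts -> _] := prod_tpermP s.
elim: ts => [|[g h] ts [l Hl]]; first by exists j => i; rewrite big_nil perm1.
have [l' [Ho Hh Hg]] := hswap l g h; exists l' => i.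
rewrite big_cons permM -Hl /=.
by case: tpermP => [->|->|/eqP ig /eqP ih] //; apply: Ho.
Qed.

Lemma envyE p g h : envy p g h = \sum_j p j * (u g (A j h) - u g (A j g)).
Proof.
rewrite /envy /expected_utility /expected_value -sumrB.
by apply: eq_bigr => j _; rewrite mulrBr.
Qed.

Lemma total_envy_ge0 p g : 0 <= total_envy p g.
Proof. by apply: sumr_ge0 => h _; rewrite le_max lexx. Qed.

(** Giving each [g] the bundle of [s g] turns [j] into another allowable allocation; the sum is the
    [p]-average of the resulting welfare gains. *)
Lemma sum_envy_perm_le0 w p (s : {perm 'I_n}) :
  supported_on_optima w p -> \sum_g w g * envy p g (s g) <= 0.
Proof.
move=> opt; under eq_bigr do rewrite envyE mulr_sumr.
rewrite exchange_big /=; apply: sumr_le0 => j _.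
have [l Hl] := swappable_perm s j; apply: le_trans (opt j l).
rewrite le_eqVlt -sumrB mulr_sumr; apply/orP; left; apply/eqP/eq_bigr => g _.
by rewrite Hl mulrCA -mulrBr.
Qed.

(** Positive envies along a cycle of [f], extended by the identity to a permutation, would have a
    positive weighted sum. *)
Lemma envy_cycle_free w p (f : 'I_n -> 'I_n) (Q : {set 'I_n}) :
  (forall g, 0 < w g) -> supported_on_optima w p -> Q != set0 ->
  (forall g, g \in Q -> f g \in Q) ->
  exists2 g, g \in Q & envy p g (f g) <= 0.
Proof.
move=> w0 opt Q0 fQ.
(* a minimal nonempty [f]-stable set is permuted by [f] *)
pose stable (C : {set 'I_n}) := (C != set0) && (f @: C \subset C).
have stableQ : stable Q.
  by rewrite /stable Q0; apply/subsetP => _ /imsetP[g gQ ->]; apply: fQ.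
have [C /minsetP[/andP[C0 fC] minC] CQ] := minset_exists stableQ.
have fCC : f @: C = C.
  by apply: minC (fC); rewrite /stable imset_eq0 C0 imsetS.
have injC : {in C &, injective f} by apply/imset_injP; rewrite fCC.
pose t g := if g \in C then f g else g.
have t_inj : injective t.
  have fCin g : g \in C -> f g \in C by move=> gC; rewrite -fCC imset_f.
  move=> g h; rewrite /t.
  have [gC|gC] := boolP (g \in C); have [hC|hC] := boolP (h \in C) => //.
  - exact: injC.
  - by move=> gh; rewrite -gh fCin in hC.
  - by move=> gh; rewrite gh fCin in gC.
have [/existsP[g /andP[gC eg]]|] := boolP [exists g, (g \in C) && (envy p g (f g) <= 0)].
  by exists g => //; apply: (subsetP CQ).
rewrite negb_exists => /forallP pos.
have posC g : g \in C -> 0 < envy p g (f g).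
  by move=> gC; have := pos g; rewrite gC /= -ltNge.
have := sum_envy_perm_le0 (perm t_inj) opt; rewrite leNgt => /negP[].
have [g0 g0C] := set0Pn _ C0.
have envyxx g : envy p g g = 0 by rewrite /envy subrr.
rewrite (bigD1 g0) //= permE /t g0C ltr_pwDl ?mulr_gt0 ?posC //.
apply: sumr_ge0 => g _; rewrite permE; case: ifP => gC; last by rewrite envyxx mulr0.
by rewrite mulr_ge0 // ltW ?posC.
Qed.

(* Swapping the bundles of [g] and [h] cannot increase the welfare, so a player
   [h] envied by [g] cannot have a much smaller weight than [g]. *)
Lemma exists_weight_ratio_bound :
  exists2 K : R, 1 <= K &
    forall w p, (forall g, 0 < w g) -> (forall j, 0 <= p j) ->
      supported_on_optima w p ->
      forall g h, 0 < envy p g h -> w g <= K * w h.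
Proof.
(* the ratio is 0 by convention when [g] is indifferent *)
pose ratio j g h := `|u h (A j h) - u h (A j g)| / `|u g (A j h) - u g (A j g)|.
have ratio0 j g h : 0 <= ratio j g h by rewrite divr_ge0.
exists (1 + \sum_j \sum_g \sum_h ratio j g h).
  by rewrite lerDl; do 3![apply: sumr_ge0 => ? _].
move=> w p w0 p0 opt g h; rewrite envyE => egh.
have gh : g != h.
  apply: contraTneq egh => <-; rewrite big1 ?ltxx // => j _.
  by rewrite subrr mulr0.
have [j pj ugh] : exists2 j, 0 < p j & 0 < u g (A j h) - u g (A j g).
  have [/existsP[j /andP[pj uj]]|] :=
    boolP [exists j, (0 < p j) && (0 < u g (A j h) - u g (A j g))]; first by exists j.
  rewrite negb_exists => /forallP H; move: egh; rewrite ltNge => /negP[].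
  apply: sumr_le0 => j _; have := H j; rewrite negb_and -!leNgt => /orP[pj|uj].
    have -> : p j = 0 by apply: le_anti; rewrite pj p0.
    by rewrite mul0r.
  by rewrite mulr_ge0_le0.
set K := 1 + _.
have leK : ratio j g h <= K.
  have term_le (I : finType) (F : I -> R) i : (forall i, 0 <= F i) -> F i <= \sum_i F i.
    by move=> F0; rewrite (bigD1 i) //= lerDl sumr_ge0.
  apply: le_trans (term_le _ (ratio j g) h (ratio0 j g)) _.
  apply: le_trans (term_le _ (fun g => \sum_h ratio j g h) g _) _.
    by move=> g'; apply: sumr_ge0.
  apply: le_trans (term_le _ (fun j => \sum_g \sum_h ratio j g h) j _) _.
    by move=> j'; do 2![apply: sumr_ge0 => ? _].
  by rewrite lerDr.
have [l Hl] := swappable_perm (tperm g h) j.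
have := opt j l; rewrite pmulr_rle0 // /welfare -sumrB.
rewrite (bigD1 g) //= (bigD1 h) 1?eq_sym //=.
rewrite big1 ?addr0 => [|i /andP[ig ih]]; last first.
  by rewrite Hl tpermD 1?eq_sym // subrr.
rewrite !Hl tpermL tpermR -!mulrBr => swap.
move: leK; rewrite /ratio (gtr0_norm ugh) ler_pdivrMr // => leK.
rewrite -(ler_pM2r ugh) mulrAC.
apply: le_trans (_ : w h * `|u h (A j h) - u h (A j g)| <= _); last first.
  by rewrite mulrC ler_pM2r.
rewrite -subr_le0; apply: le_trans swap; rewrite lerD2l -mulrN ler_pM2l //.
by rewrite lerNl opprB ler_norm.
Qed.

Lemma supported_on_optima_pareto w p :
  (forall g, 0 < w g) -> mixed_allocation p -> supported_on_optima w p ->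
  pareto_efficient u A p.
Proof.
move=> w0 [p0 p1] opt [p' [[p'0 p'1] ge [g gt]]].
have sumE r : \sum_i w i * expected_utility u A r i = \sum_j r j * welfare w j.
  under eq_bigr do rewrite mulr_sumr.
  rewrite exchange_big /=; apply: eq_bigr => j _.
  by rewrite mulr_sumr; apply: eq_bigr => i _; rewrite mulrCA.
have : \sum_i w i * expected_utility u A p i < \sum_i w i * expected_utility u A p' i.
  rewrite (bigD1 g) //= [ltRHS](bigD1 g) //= ltr_leD ?ltr_pM2l //.
  by apply: ler_sum => i _; rewrite ler_pM2l.
rewrite !sumE ltNge => /negP[].
(* Both averages are written over the product of [p] and [p'], so that optimality applies term by
   term. *)
have -> : \sum_j p' j * welfare w j = \sum_j \sum_l p j * p' l * welfare w l.
  rewrite exchange_big /=; apply: eq_bigr => l _.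
  by rewrite -mulr_suml -mulr_suml p1 mul1r.
have -> : \sum_j p j * welfare w j = \sum_j \sum_l p j * p' l * welfare w j.
  by apply: eq_bigr => j _; rewrite -mulr_suml -mulr_sumr p'1 mulr1.
apply: ler_sum => j _; apply: ler_sum => l _.
rewrite -subr_ge0 -mulrBr mulrAC mulrC -oppr_le0 -mulrN -mulrN opprB.
by rewrite mulr_ge0_le0.
Qed.

(** The bound on [e] suits a walk of at most [n] envies: it starts at weight at least [1/n], and
    each step divides the weight by at most [K]. *)
Lemma balanced_envy_free (K e : R) (q : 'I_n -> R) p :
  1 <= K ->
  (forall w p, (forall g, 0 < w g) -> (forall j, 0 <= p j) ->
     supported_on_optima w p ->
     forall g h, 0 < envy p g h -> w g <= K * w h) ->
  0 < e -> e < (n%:R * K ^+ n)^-1 ->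
  (forall g, 0 <= q g) -> \sum_g q g = 1 -> mixed_allocation p ->
  supported_on_optima (fun g => Num.max e (q g)) p ->
  (forall g, q g * \sum_h total_envy p h <= total_envy p g) ->
  envy_free u A p.
Proof.
pose w g := Num.max e (q g); pose S := \sum_h total_envy p h.
move=> K1 ratioK e0 elt q0 q1 [p0 p1] opt bal.
have w0 g : 0 < w g by rewrite lt_max e0.
have K0 : 0 < K := lt_le_trans ltr01 K1.
(* As [q] sums to 1, both sides of [bal] have the same sum over [g], so no inequality is strict. *)
have totE g : total_envy p g = q g * S.
  apply/eqP; rewrite -subr_eq0; apply/eqP.
  apply: (psumr_eq0P (P := xpredT) (F := fun g => total_envy p g - q g * S)) => // [i _|].
    by rewrite subr_ge0.
  by rewrite sumrB -mulr_suml q1 mul1r subrr.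
have [S0|S_neq0] := eqVneq S 0.
  move=> g h; rewrite -subr_le0.
  have /eqP := totE g; rewrite S0 mulr0 psumr_eq0; last first.
    by move=> i _; rewrite le_max lexx.
  move=> /allP/(_ h); rewrite mem_index_enum => /(_ isT) /eqP max0.
  by rewrite -[leRHS]max0 le_max lexx orbT.
exfalso; have S_gt0 : 0 < S.
  by rewrite lt_neqAle eq_sym S_neq0 sumr_ge0 // => i _; apply: total_envy_ge0.
have envious g : 0 < q g -> exists h, 0 < envy p g h.
  move=> qg; have [/existsP//|] := boolP [exists h, 0 < envy p g h].
  rewrite negb_exists => /forallP H; have : total_envy p g = 0.
    by apply: big1 => h _; apply: max_l; rewrite leNgt.
  by move/eqP; rewrite totE mulf_eq0 (negbTE S_neq0) gt_eqF.
pose f g := odflt g [pick h | 0 < envy p g h].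
have fP g : 0 < q g -> 0 < envy p g (f g).
  by move=> /envious[h eh]; rewrite /f; case: pickP => //= /(_ h); rewrite eh.
have n0 : 0 < n%:R :> R.
  rewrite ltr0n lt0n; apply/eqP => n0; have := oner_neq0 R; rewrite -q1 big1 ?eqxx //.
  by move=> [i ilt] _; exfalso; rewrite n0 in ilt.
have [g1 qg1] : exists g1, n%:R^-1 <= q g1.
  have [/existsP//|] := boolP [exists g1, n%:R^-1 <= q g1].
  rewrite negb_exists => /forallP H; have : \sum_g q g < \sum_(g < n) n%:R^-1.
    apply: ltr_sum; last by move=> g _; rewrite ltNge.
    by rewrite ltr0n in n0; apply/hasP; exists (Ordinal n0); rewrite ?mem_index_enum.
  by rewrite sumr_const card_ord q1 -[ltRHS]mulr_natl divff ?ltxx ?gt_eqF.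
have Kn i : (i <= n)%N -> K ^+ i <= K ^+ n by move=> ?; apply: ler_weXn2l.
(* Such a weight is above [e], hence comes from [q g], and [g] is envious in turn. *)
have big_q g i : (i <= n)%N -> n%:R^-1 <= K ^+ i * w g -> 0 < q g.
  move=> lin wg; have : e < w g.
    apply: lt_le_trans elt _; rewrite invfM.
    rewrite ler_pdivrMr ?exprn_gt0 // mulrC.
    by apply: le_trans wg _; rewrite ler_pM2r ?w0 ?Kn.
  by rewrite lt_max ltxx /= => /(lt_trans e0).
have wi i : (i <= n)%N -> n%:R^-1 <= K ^+ i * w (iter i f g1).
  elim: i => [|i IH] lin; first by rewrite expr0 mul1r le_max qg1 orbT.
  have wi := IH (ltnW lin); apply: le_trans wi _.
  rewrite exprSr -mulrA ler_pM2l ?exprn_gt0 //=.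
  by apply: (ratioK w p) => //; apply: fP; apply: big_q (IH (ltnW lin)); apply: ltnW.
have [||g] := @envy_cycle_free w p f [set g | fconnect f g1 g] w0 opt.
- by apply/set0Pn; exists g1; rewrite inE connect0.
- by move=> g; rewrite !inE => /connect_trans; apply; apply: fconnect1.
rewrite inE => g1g; rewrite leNgt => /negP[]; apply: fP.
have lin : (findex f g1 g <= n)%N.
  rewrite ltnW // (leq_trans (findex_max g1g)) //.
  by rewrite -[X in (_ <= X)%N]card_ord max_card.
by apply: (big_q _ (findex f g1 g)) => //; rewrite -[X in w X](iter_findex g1g) wi.
Qed.

End Envy.

(* Imported only now, because [classical_sets] shadows the finite set notations
   used above. *)
From mathcomp Require Import interval_inference classical_sets.
From mathcomp Require Import topology normedtype sequences exp.
Import numFieldNormedType.Exports.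

(** * Complementary points in the simplex *)

Definition simplex (R : realType) (n : nat) : set 'rV[R]_n :=
  [set q | (forall i, 0 <= q 0 i) /\ \sum_i q 0 i = 1]%classic%R.
Arguments simplex {R} n _.

Section SimplexLimits.
Local Open Scope classical_set_scope.
Local Open Scope ring_scope.

Variable R : realType.

Lemma compact_simplex (n : nat) : compact (@simplex R n).
Proof.
have box : compact [set q : 'rV[R]_n | forall i, `[0, 1]%classic (q ord0 i)].
  apply: (rV_compact (A := fun=> `[0 : R, 1]%classic)) => _; exact: segment_compact.
apply: subclosed_compact box _; last first.
  move=> q [q0 q1] i; rewrite /= in_itv /= q0 /= -q1 (bigD1 i) //= lerDl.
  by apply: sumr_ge0.
rewrite (_ : @simplex R n = \bigcap_i [set q : 'rV[R]_n | 0 <= q 0 i] `&`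
                         [set q : 'rV[R]_n | \sum_i q 0 i = 1]); last first.
  by apply/seteqP; split => q [q0 q1]; split=> // i; [move=> _|]; apply: q0.
apply: closedI.
  apply: closed_bigI => i _.
  apply: (@preimage_closed _ _ (fun q : 'rV[R]_n => q 0 i) [set x : R | 0 <= x]).
    by move=> q _; apply: coord_continuous.
  exact: closed_ge.
apply: (@preimage_closed _ _ (fun q : 'rV[R]_n => \sum_i q 0 i) [set x : R | x = 1]).
  move=> q _; apply: continuous_big => [|i _]; last exact: coord_continuous.
  exact: add_continuous.
exact: closed_eq.
Qed.

(** Cluster points stand in for limits of subsequences. *)
Lemma compact_cluster_seq (T : topologicalType) (K : set T) (x : nat -> T) :
  compact K -> (forall t, K (x t)) ->
  exists2 q, K q & forall B, nbhs q B -> forall t0, exists2 t, (t0 <= t)%N & B (x t).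
Proof.
move=> cK Kx; have [|q [Kq xq]] := cK (x @ \oo) _.
  by exists 0%N => // t _; apply: Kx.
exists q => // B qB t0.
have [|y [[t /= t0t <-] Bt]] := xq (x @` [set t | (t0 <= t)%N]) B _ qB.
  by exists t0 => // t /= t0t; exists t.
by exists t.
Qed.

Lemma cluster_seq_le0 (T : topologicalType) (x : nat -> T) (q : T) (F : T -> R) :
  (forall B, nbhs q B -> forall t0, exists2 t, (t0 <= t)%N & B (x t)) ->
  {for q, continuous F} -> (forall t, F (x t) <= t.+1%:R^-1) -> F q <= 0.
Proof.
move=> xq cF Fx; rewrite leNgt; apply/negP => Fq0.
have Fq2 : 0 < F q / 2 by rewrite divr_gt0.
have [t0 _ ht0] := near_infty_natSinv_lt (PosNum Fq2).
have nq : nbhs q [set y | F q / 2 < F y].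
  have : F q / 2 < F q by rewrite gtr_pMr ?invf_lt1 // ltr1n.
  by move/lt_nbhsr => /cF.
have [t /ht0 /= lt_t] := xq _ nq t0.
by apply/negP; rewrite -leNgt (le_trans (Fx t)) // ltW.
Qed.

(** Label each grid point by some [g] with [G g] nonnegative there, and let the mesh tend to 0. Near
    a cluster point [q] there is, for each [g], a grid point where [G g] is nonnegative or
    coordinate [g] is almost 0; by continuity the alternative passes to [q]. *)
Lemma exists_simplex_complementary (n : nat) (i0 : 'I_n) (G : 'I_n -> 'rV[R]_n -> R) :
  (forall g, continuous (G g)) ->
  (forall q, simplex n q -> exists g, 0 <= G g q) ->
  exists2 q, simplex n q & forall g, q 0 g = 0 \/ 0 <= G g q.
Proof.
move=> cG labG.
pose pt (t : nat) (f : 'I_n -> nat) : 'rV[R]_n := \row_i ((f i)%:R / t.+1%:R).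
have pt_simplex t f : (\sum_i f i = t.+1)%N -> simplex n (pt t f).
  move=> sumf; split=> [i|]; first by rewrite mxE divr_ge0.
  under eq_bigr do rewrite mxE.
  by rewrite -mulr_suml -natr_sum sumf divff // pnatr_eq0.
have /choice[c cP] : forall tf : nat * ('I_n -> nat), exists g,
    (\sum_i tf.2 i = tf.1.+1)%N -> 0 <= G g (pt tf.1 tf.2).
  move=> [t f] /=; have [sumf|nsum] := eqVneq (\sum_i f i)%N t.+1.
    by have [g Gg] := labG _ (pt_simplex _ _ sumf); exists g.
  by exists i0 => sumf; rewrite sumf eqxx in nsum.
have /choice[s sP] := fun t => exists_close_labelled_points t.+1 i0 (fun f => c (t, f)).
have sum_s t g : (\sum_i s t g i = t.+1)%N by have [] := sP t.
have close t g h i : (s t g i < s t h i + n)%N by have [] := sP t.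
have labs t g : c (t, s t g) = g \/ (s t g g < n)%N by have [] := sP t.
have [q Kq xq] := compact_cluster_seq (@compact_simplex n)
  (fun t => pt_simplex t (s t i0) (sum_s t i0)).
exists q => // g; have [->|qg] := eqVneq (q 0 g) 0; [by left|right].
have qg0 : 0 < q 0 g by rewrite lt_neqAle eq_sym qg; case: Kq => + _; apply.
rewrite leNgt; apply/negP => Gq.
have : \forall y \near q, G g y < 0 /\ q 0 g / 2 < y 0 g.
  near=> y; split; near: y.
    exact: (cG g q _ (lt_nbhsl Gq)).
  have q2 : q 0 g / 2 < q 0 g by rewrite gtr_pMr ?invf_lt1 // ltr1n.
  exact: (@coord_continuous _ _ _ 0 g q _ (lt_nbhsr q2)).
move=> /nbhs_ballP[e /= e0 qe].
have n0 : 0 < n%:R :> R by rewrite ltr0n (leq_ltn_trans (leq0n i0)).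
(* At this mesh [n] grid steps, which bound both the spread of the points and a small coordinate
   [g], are shorter than [e / 2] and [q 0 g / 2]. *)
have d0 : 0 < Num.min (e / 2) (q 0 g / 2) / n%:R.
  by rewrite divr_gt0 // lt_min !divr_gt0.
have [t0 _ ht0] := near_infty_natSinv_lt (PosNum d0).
have e20 : 0 < e / 2 by rewrite divr_gt0.
have [t /ht0 /= lt_t qx] := xq _ (nbhsx_ballx q _ e20) t0.
have nt : n%:R / t.+1%:R < e / 2 /\ n%:R / t.+1%:R < q 0 g / 2.
  by move: lt_t; rewrite ltr_pdivlMr // mulrC lt_min => /andP[].
have ptB h i (a b : 'I_n -> nat) : (a i < b i + h)%N ->
    pt t a 0 i <= pt t b 0 i + h%:R / t.+1%:R.
  by move=> ab; rewrite !mxE -mulrDl -natrD ler_pM2r ?invr_gt0 // ler_nat ltnW.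
have yq : ball q e (pt t (s t g)).
  split=> // i j; rewrite ord1 {i}.
  have qxj : `|q 0 j - pt t (s t i0) 0 j| < e / 2 by case: qx => _ /(_ 0 j).
  change (`|q 0 j - pt t (s t g) 0 j| < e).
  have := ptB _ _ _ _ (close t g i0 j); have := ptB _ _ _ _ (close t i0 g j).
  move: nt qxj => [nt _]; rewrite !ltr_norml.
  move: nt; move: (_ / _) (pt t _ 0 j) (pt t _ 0 j) => d a b.
  by move=> ? /andP[? ?] ? ?; apply/andP; split; lra.
have [Gy qy] := qe _ yq.
have [cg|sg] := labs t g.
  by have := cP (t, s t g) (sum_s t g); rewrite /= cg leNgt Gy.
move: qy; apply/negP; rewrite -leNgt mxE; apply/ltW/(le_lt_trans _ (proj2 nt)).
by rewrite ler_pM2r ?invr_gt0 // ler_nat ltnW.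
Unshelve. all: by end_near.
Qed.

End SimplexLimits.

(** * Softmax lotteries and their zero-temperature limit *)

Section BalancedAllocation.
Local Open Scope classical_set_scope.
Local Open Scope ring_scope.
Variables (R : realType) (n m k : nat).
Variables (u : 'I_n -> {set 'I_m} -> R) (A : 'I_k -> bundles n m).

(** A continuous substitute for choosing a maximizer of [V], with inverse temperature [T]. *)
Definition softmax (T : R) (V : 'I_k -> R) (j : 'I_k) : R :=
  expR (T * V j) / \sum_l expR (T * V l).

Lemma sum_expR_gt0 (T : R) (V : 'I_k -> R) (j : 'I_k) :
  0 < \sum_l expR (T * V l).
Proof.
rewrite (bigD1 j) //= ltr_pwDl ?expR_gt0 //.
by apply: sumr_ge0 => l _; apply: expR_ge0.
Qed.

Lemma softmax_mixed (T : R) (V : 'I_k -> R) :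
  (0 < k)%N -> mixed_allocation (softmax T V).
Proof.
move=> k0; have S0 := sum_expR_gt0 T V (Ordinal k0).
split=> [j|]; first by rewrite divr_ge0 ?expR_ge0 // ltW.
by rewrite -mulr_suml divff // gt_eqF.
Qed.

(** Optimality up to an error that vanishes as [T] grows. It comes from [x <= expR x] at
    [x = T * (V l - V j)], since the denominator is at least [expR (T * V l)]. *)
Lemma softmax_gap (T : R) (V : 'I_k -> R) (j l : 'I_k) :
  0 < T -> softmax T V j * (V l - V j) <= T^-1.
Proof.
move=> T0; rewrite /softmax mulrAC ler_pdivrMr ?(sum_expR_gt0 T V j) //.
rewrite -[leRHS]mulrC ler_pdivlMr //.
have le_sum : expR (T * V l) <= \sum_l expR (T * V l).
  by rewrite (bigD1 l) //= lerDl sumr_ge0 // => i _; apply: expR_ge0.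
apply: le_trans le_sum.
have -> : expR (T * V l) = expR (T * V j) * expR (T * (V l - V j)).
  by rewrite -expRD; congr expR; ring.
rewrite -mulrA ler_pM2l ?expR_gt0 // mulrC.
by apply: le_trans (expR_ge1Dx _); rewrite lerDr.
Qed.

Section Continuity.
Variables (X : topologicalType) (x : X).

Lemma continuous_sub_at (f g : X -> R) :
  {for x, continuous f} -> {for x, continuous g} ->
  {for x, continuous (fun y => f y - g y)}.
Proof. by move=> cf cg; apply: cvgB. Qed.

Lemma continuous_mul_at (f g : X -> R) :
  {for x, continuous f} -> {for x, continuous g} ->
  {for x, continuous (fun y => f y * g y)}.
Proof. by move=> cf cg; apply: cvgM. Qed.

Lemma continuous_sum_at (I : finType) (F : I -> X -> R) :
  (forall i, {for x, continuous (F i)}) ->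
  {for x, continuous (fun y => \sum_i F i y)}.
Proof. by move=> cF; apply: cvg_big => [|i _]; [apply: add_continuous|apply: cF]. Qed.

Lemma continuous_max_const (c : R) (f : X -> R) :
  {for x, continuous f} -> {for x, continuous (fun y => Num.max c (f y))}.
Proof. by move=> cf; apply: (@continuous_max _ _ (fun=> c) f x) => //; apply: cvg_cst. Qed.

Lemma continuous_welfare (w : X -> 'I_n -> R) (j : 'I_k) :
  (forall i, {for x, continuous (w^~ i)}) ->
  {for x, continuous (fun y => welfare u A (w y) j)}.
Proof.
move=> cw; apply: continuous_sum_at => i.
by apply: cvgM; [apply: cw|apply: cvg_cst].
Qed.

Lemma continuous_total_envy (p : X -> 'I_k -> R) (g : 'I_n) :
  (forall j, {for x, continuous (p^~ j)}) ->
  {for x, continuous (fun y => total_envy u A (p y) g)}.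
Proof.
move=> cp; apply: continuous_sum_at => h; apply: continuous_max_const.
by apply: cvgB; apply: continuous_sum_at => j;
  apply: cvgM; [apply: cp|apply: cvg_cst|apply: cp|apply: cvg_cst].
Qed.

Lemma continuous_softmax (T : R) (V : X -> 'I_k -> R) (j : 'I_k) :
  (forall l, {for x, continuous (V^~ l)}) ->
  {for x, continuous (fun y => softmax T (V y) j)}.
Proof.
move=> cV; have cE l : {for x, continuous (fun y => expR (T * V y l))}.
  apply: continuous_comp; last exact: continuous_expR.
  by apply: cvgM; [apply: cvg_cst|apply: cV].
apply: cvgM; first exact: cE.
by apply: cvgV; [rewrite gt_eqF ?sum_expR_gt0|apply: continuous_sum_at].
Qed.

End Continuity.

(** The differences [G g q] sum to 0 over [g] on the simplex, so one of them is nonnegative and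
    complementarity applies. Where [q 0 g = 0] the inequality is just nonnegativity of total
    envy. *)
Lemma exists_balanced_softmax (e T : R) :
  (0 < n)%N -> (0 < k)%N ->
  exists2 q : 'rV[R]_n, simplex n q &
    let p := softmax T (welfare u A (fun i => Num.max e (q 0 i))) in
    forall g, q 0 g * \sum_h total_envy u A p h <= total_envy u A p g.
Proof.
move=> n0 k0.
pose p (q : 'rV[R]_n) := softmax T (welfare u A (fun i => Num.max e (q 0 i))).
pose G g q := total_envy u A (p q) g - q 0 g * \sum_h total_envy u A (p q) h.
have [||q Kq Gq] := @exists_simplex_complementary R n (Ordinal n0) G.
- move=> g q.
  have cp j : {for q, continuous (fun q => p q j)}.
    apply: (@continuous_softmax _ q T
      (fun q : 'rV[R]_n => welfare u A (fun i => Num.max e (q 0 i)))) => l.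
    apply: (@continuous_welfare _ q (fun (q : 'rV[R]_n) i => Num.max e (q 0 i))) => i.
    by apply: continuous_max_const; apply: coord_continuous.
  have cE h := @continuous_total_envy _ q p h cp.
  have cq : {for q, continuous (fun q : 'rV[R]_n => q 0 g)} by apply: coord_continuous.
  exact: (continuous_sub_at (cE g) (continuous_mul_at cq (continuous_sum_at cE))).
- move=> q [q0 q1].
  have [/existsP//|] := boolP [exists g, 0 <= G g q].
  rewrite negb_exists => /forallP H.
  have : \sum_g G g q < 0.
    rewrite -oppr_gt0 -sumrN (bigD1 (Ordinal n0)) //= ltr_pwDl ?oppr_gt0 ?ltNge //.
    by apply: sumr_ge0 => g _; rewrite oppr_ge0 ltW // ltNge.
  by rewrite /G sumrB -mulr_suml q1 mul1r subrr ltxx.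
exists q => // p' g; have [qg|] := Gq g; last by rewrite /G subr_ge0.
by rewrite qg mul0r total_envy_ge0.
Qed.

Lemma exists_balanced_optimum (e : R) :
  (0 < n)%N -> (0 < k)%N ->
  exists q p, [/\ simplex n q, mixed_allocation p,
    supported_on_optima u A (fun i => Num.max e (q 0 i)) p &
    forall g, q 0 g * \sum_h total_envy u A p h <= total_envy u A p g].
Proof.
move=> n0 k0.
have /choice[q qP] : forall t : nat, exists q : 'rV[R]_n, simplex n q /\
    let p := softmax t.+1%:R (welfare u A (fun i => Num.max e (q 0 i))) in
    forall g, q 0 g * \sum_h total_envy u A p h <= total_envy u A p g.
  by move=> t; have [q ? ?] := exists_balanced_softmax e t.+1%:R n0 k0; exists q.
pose wt (q : 'rV[R]_n) i := Num.max e (q 0 i).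
pose pt t := softmax t.+1%:R (welfare u A (wt (q t))).
(* The lottery is recorded beside [q]: at ties in welfare the limit lottery is not determined by the
   limit of [q]. *)
pose x t : 'rV[R]_n * 'rV[R]_k := (q t, \row_j pt t j).
have rowE t : (fun j => (x t).2 0 j) = pt t by apply/funext => j; rewrite mxE.
have Kx t : (simplex n `*` simplex k) (x t).
  split; first by have [] := qP t.
  have [p0 p1] := softmax_mixed t.+1%:R (welfare u A (wt (q t))) k0.
  split=> [j|]; first by rewrite mxE; apply: p0.
  by under eq_bigr do rewrite mxE.
have [[q' p'] [Kq [p0 p1]] xq] :=
  compact_cluster_seq (compact_setX (@compact_simplex R n) (@compact_simplex R k)) Kx.
have cq i : {for (q', p'), continuous (fun y : 'rV[R]_n * 'rV[R]_k => y.1 0 i)}.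
  by apply: (continuous_comp (f := fst) (g := fun q : 'rV[R]_n => q 0 i));
    [apply: cvg_fst|apply: coord_continuous].
have cp j : {for (q', p'), continuous (fun y : 'rV[R]_n * 'rV[R]_k => y.2 0 j)}.
  by apply: (continuous_comp (f := snd) (g := fun q : 'rV[R]_k => q 0 j));
    [apply: cvg_snd|apply: coord_continuous].
have cE g : {for (q', p'), continuous
    (fun y : 'rV[R]_n * 'rV[R]_k => total_envy u A (fun j => y.2 0 j) g)}.
  exact: (@continuous_total_envy _ (q', p')
    (fun (y : 'rV[R]_n * 'rV[R]_k) j => y.2 0 j)).
have cW l : {for (q', p'), continuous
    (fun y : 'rV[R]_n * 'rV[R]_k => welfare u A (wt y.1) l)}.
  apply: (@continuous_welfare _ (q', p')
    (fun (y : 'rV[R]_n * 'rV[R]_k) i => wt y.1 i)) => i.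
  exact: continuous_max_const.
exists q', (fun j => p' 0 j); split=> //.
  move=> j l.
  apply: (cluster_seq_le0 (F := fun y : 'rV[R]_n * 'rV[R]_k =>
    y.2 0 j * (welfare u A (wt y.1) l - welfare u A (wt y.1) j)) xq).
    by apply: continuous_mul_at; [apply: cp|apply: continuous_sub_at; apply: cW].
  by move=> t; rewrite /= mxE; apply: softmax_gap.
move=> g; rewrite -subr_le0.
apply: (cluster_seq_le0 (F := fun y : 'rV[R]_n * 'rV[R]_k =>
  y.1 0 g * \sum_h total_envy u A (fun j => y.2 0 j) h -
  total_envy u A (fun j => y.2 0 j) g) xq).
  apply: continuous_sub_at; last exact: cE.
  by apply: continuous_mul_at; [apply: cq|apply: continuous_sum_at].
move=> t; rewrite rowE; apply: le_trans (_ : 0 <= _); last by rewrite invr_ge0.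
by rewrite subr_le0; have [_] := qP t; apply.
Qed.

End BalancedAllocation.

Theorem theorem3p1 (R : realType) (n m k : nat) (hk : (0 < k)%N)
    (u : 'I_n -> {set 'I_m} -> R) (A : 'I_k -> bundles n m)
    (hA : forall j : 'I_k, is_allocation (A j)) (hswap : swappable A) :
  exists p : 'I_k -> R,
    [/\ mixed_allocation p, pareto_efficient u A p & envy_free u A p].
Proof.
have [n0|n_gt0] := posnP n.
  (* Without players any lottery will do; this one is uniform. *)
  exists (softmax 0%R (fun=> 0%R)); split; first exact: softmax_mixed.
    by move=> [p' [_ _ [[i ilt] _]]]; exfalso; rewrite n0 in ilt.
  by move=> [i ilt]; exfalso; rewrite n0 in ilt.
have [K K1 ratioK] := exists_weight_ratio_bound u hswap.
have b0 : (0 < (n%:R * K ^+ n)^-1)%R.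
  by rewrite invr_gt0 mulr_gt0 ?ltr0n // exprn_gt0 // (lt_le_trans ltr01).
pose e : R := ((n%:R * K ^+ n)^-1 / 2)%R.
have e0 : (0 < e)%R by rewrite divr_gt0.
have elt : (e < (n%:R * K ^+ n)^-1)%R by rewrite gtr_pMr // invf_lt1 // ltr1n.
have [q [p [[q0 q1] mp opt bal]]] := exists_balanced_optimum u A e n_gt0 hk.
exists p; split=> //.
  by apply: supported_on_optima_pareto mp opt => g; rewrite lt_max e0.
exact: balanced_envy_free K1 ratioK e0 elt q0 q1 mp opt bal.
Qed.
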